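(* Let $n\ge 2$ be an integer. The graph on $Z_n^*=Z_n\setminus\{0\}$ generated by the two maps $T(x)=x^2$ and $S(x)=x^3$ is connected if and only if $n$ is a Pierpont prime, that is, a prime of the form $n=2^t3^s+1$ with integers $s,t\ge 0$.
   Context: $Z_n=\mathbb{Z}/n\mathbb{Z}$ and $Z_n^*=Z_n\setminus\{0\}$ denotes the set of nonzero residue classes modulo $n$ (not the group of units). The graph generated by maps $T,S:Z_n\to Z_n$ on a vertex set $V\subseteq Z_n$ is the finite simple undirected graph with vertex set $V$ in which two distinct points $x,y\in V$ are joined by an edge if and only if at least one of $T(x)=y$, $T(y)=x$, $S(x)=y$, $S(y)=x$ holds (directions, self-loops and multiple connections are disregarded). *)

(* Defs.v *)
From mathcomp Require Import all_boot all_order all_algebra.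

Set Implicit Arguments.
Unset Strict Implicit.
Unset Printing Implicit Defensive.

(* The vertices form the subtype of V, so that a path never leaves V even though
   T and S may map points of V outside V. *)
Definition generated_graph (X : finType) (V : {set X}) (T S : X -> X) :
    rel {x : X | x \in V} :=
  fun u v => let x := val u in let y := val v in
    (x != y) && [|| T x == y, T y == x, S x == y | S y == x].

Lemma generated_graph_sym (X : finType) (V : {set X}) (T S : X -> X) :
  symmetric (@generated_graph X V T S).
Proof.
move=> u v; rewrite /generated_graph eq_sym; congr (_ && _).
by case: (T _ == _); case: (T _ == _); case: (S _ == _); case: (S _ == _).
Qed.

Lemma generated_graph_irr (X : finType) (V : {set X}) (T S : X -> X) :
  irreflexive (@generated_graph X V T S).
Proof. by move=> u; rewrite /generated_graph eqxx. Qed.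

(* The graph without vertices is not connected. *)
Definition connected_graph (G : finType) (e : rel G) : Prop :=
  (0 < #|G|)%N /\ forall u v : G, connect e u v.

Definition pierpont_prime (n : nat) : Prop :=
  prime n /\ exists s t : nat, n = (2 ^ t * 3 ^ s + 1)%N.

(* Main.v *)
Require Import Defs.
From mathcomp Require Import all_boot all_order all_algebra all_field.

(** Squaring and cubing preserve, in both directions, the property of being a
    unit and, when n is prime, the property x ^ m = 1 where m is the part of
    n - 1 built from the primes 2 and 3.  Such a property is constant on every
    connected component of the graph ([connect_invariant]), and both hold
    at 1, so connectedness forces them on all nonzero x.

    - If every nonzero residue modulo n is a unit, then n is prime.

    - If n is prime, the nonzero residues are the N = n - 1 nonzero elements of
      a field; write N = m * r with m = 2 ^ t * 3 ^ s and r coprime to 6.  If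
      x ^ m = 1 for all of them, then 'X^m - 1 has N roots, so N <= m, r = 1 and
      n is a Pierpont prime.

    Conversely, if N = 2 ^ t * 3 ^ s, then t squarings and s cubings lead from
    any nonzero x to x ^ N = 1, so every vertex is connected to 1.

    The prime case only uses the field structure and is carried out in an
    arbitrary finite field ([finField_connectedP]). *)

Set Implicit Arguments.
Unset Strict Implicit.
Unset Printing Implicit Defensive.

Import GRing.Theory.
Local Open Scope ring_scope.

Lemma connect_invariant (X : finType) (V : {set X}) (T S : X -> X)
    (P : pred X) (u v : {x : X | x \in V}) :
    (forall x, P (T x) = P x) -> (forall x, P (S x) = P x) ->
  connect (generated_graph T S) u v -> P (val u) = P (val v).
Proof.
move=> PT PS; apply: (@closed_connect _ _ [pred w | P (val w)]) => {}u {}v.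
by case/andP=> _ /or4P[] /eqP /(congr1 P); rewrite ?PT ?PS.
Qed.

(** Fixed points cause the case distinction: the graph has no loops. *)
Lemma connect_generator (X : finType) (V : {set X}) (T S : X -> X)
    (u v : {x : X | x \in V}) :
  T (val u) = val v \/ S (val u) = val v -> connect (generated_graph T S) u v.
Proof.
move=> uv; have [/val_inj-> // | neq_uv] := eqVneq (val u) (val v).
apply: connect1; rewrite /generated_graph neq_uv /=.
by case: uv => ->; rewrite eqxx ?orbT.
Qed.

Lemma expr_coprime_eq1 (R : pzSemiRingType) (y : R) (j k : nat) :
  coprime j k -> y ^+ j = 1 -> y ^+ k = 1 -> y = 1.
Proof.
case: j => [|j] cjk yj yk.
  by move: cjk yk; rewrite /coprime gcd0n => /eqP->.
case: (egcdnP k (ltn0Sn j)) => a b; rewrite (eqP cjk) => bezout _.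
move/(congr1 (GRing.exp y)): bezout.
by rewrite exprD !(mulnC _ j.+1, mulnC _ k) !exprM yj yk !expr1n mul1r expr1.
Qed.

Lemma factor23 (N : nat) : (0 < N)%N ->
  exists t s r : nat,
    [/\ N = (2 ^ t * 3 ^ s * r)%N, coprime 2 r & coprime 3 r].
Proof.
move=> N_gt0; have [M co2M defN] := pfactor_coprime (erefl : prime 2) N_gt0.
have M_gt0 : (0 < M)%N by move: N_gt0; rewrite defN muln_gt0 => /andP[].
have [r co3r defM] := pfactor_coprime (erefl : prime 3) M_gt0.
exists (logn 2 N), (logn 3 M), r; split=> //.
  by rewrite mulnAC -mulnA -defM mulnC.
by move: co2M; rewrite defM coprimeMr => /andP[].
Qed.

Section FiniteField.

Variable F : finFieldType.

Let sq (x : F) := x ^+ 2.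
Let cube (x : F) := x ^+ 3.
Let vertex := {x : F | x \in [set~ 0]}.
Let e : rel vertex := generated_graph sq cube.

Let vertex_neq0 (u : vertex) : val u != 0.
Proof. by have := valP u; rewrite !inE. Qed.

Let in_vertices (x : F) : x != 0 -> x \in [set~ 0].
Proof. by rewrite !inE. Qed.

Let one : vertex := Sub 1 (in_vertices (oner_neq0 F)).

Lemma finField_expr_eq1 (x : F) : x != 0 -> x ^+ #|F|.-1 = 1.
Proof.
move=> x_neq0; apply: (mulfI x_neq0).
by rewrite -exprS prednK ?expf_card ?mulr1 // (cardD1 x).
Qed.

Lemma finField_leq_exponent (m : nat) : (0 < m)%N ->
  (forall x : F, x != 0 -> x ^+ m = 1) -> (#|F|.-1 <= m)%N.
Proof.
move=> m_gt0 xm1.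
have -> : #|F|.-1 = size (enum [set~ (0 : F)]) by rewrite -cardE cardsC1.
apply: (max_unity_roots m_gt0 _ (enum_uniq _)).
apply/allP => x; rewrite mem_enum !inE => /xm1 xm.
by apply/unity_rootP.
Qed.

(** The exponent prime to 6 kills y, so a square or a cube equal to 1 forces
    y = 1. *)
Lemma expr_part_invariant (m r k : nat) (x : F) :
  #|F|.-1 = (m * r)%N -> (0 < k)%N -> (0 < m)%N -> coprime k r ->
  ((x ^+ k) ^+ m == 1) = (x ^+ m == 1).
Proof.
move=> defN k_gt0 m_gt0 co_kr; rewrite exprAC.
apply/eqP/eqP=> [xmk | ->]; last by rewrite expr1n.
have x_neq0 : x != 0.
  apply/eqP => x0; move/eqP: xmk.
  by rewrite x0 -exprM expr0n muln_eq0 !gtn_eqF //= eq_sym oner_eq0.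
apply: (expr_coprime_eq1 co_kr xmk).
by rewrite -exprM -defN finField_expr_eq1.
Qed.

Lemma connect_to_one (t s : nat) (u : vertex) :
  val u ^+ (2 ^ t * 3 ^ s) = 1 -> connect e u one.
Proof.
have step k (v : vertex) : (k = 2 \/ k = 3)%N ->
  exists2 w : vertex, val w = val v ^+ k & connect e v w.
  move=> k23; exists (Sub (val v ^+ k) (in_vertices (expf_neq0 k (vertex_neq0 v)))) => //.
  by apply: connect_generator; case: k23 => ->; [left | right].
elim: t s u => [|t IHt] s u.
  elim: s u => [|s IHs] u.
    by rewrite expr1 => u1; rewrite (_ : u = one) //; apply: val_inj.
  have [w defw uw] := step 3 u (or_intror (erefl _)).
  rewrite expnS mulnCA exprM -defw => /IHs; exact: connect_trans.
have [w defw uw] := step 2 u (or_introl (erefl _)).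
rewrite expnS -mulnA exprM -defw => /IHt; exact: connect_trans.
Qed.

Lemma finField_connectedP :
  connected_graph e <-> exists s t : nat, #|F| = (2 ^ t * 3 ^ s + 1)%N.
Proof.
have F_gt1 : (1 < #|F|)%N := finNzRing_gt1 F.
have defF : #|F| = (#|F|.-1 + 1)%N by rewrite addn1 prednK // ltnW.
split=> [[_ conn] | [s [t cardF]]].
  have N_gt0 : (0 < #|F|.-1)%N by rewrite -ltnS prednK // ltnW.
  have [t [s [r [defN co2r co3r]]]] := factor23 N_gt0.
  exists s, t; rewrite defF; congr (_ + 1)%N.
  set m := (2 ^ t * 3 ^ s)%N in defN *.
  have m_gt0 : (0 < m)%N by rewrite muln_gt0 !expn_gt0.
  have m_le_N : (m <= #|F|.-1)%N by rewrite dvdn_leq // defN dvdn_mulr.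
  apply/eqP; rewrite eqn_leq m_le_N andbT.
  apply: finField_leq_exponent => // x x_neq0; apply/eqP.
  have /(connect_invariant (P := fun y => y ^+ m == 1)) :=
    conn (Sub x (in_vertices x_neq0)) one.
  rewrite /= expr1n eqxx; apply=> y; exact: expr_part_invariant defN _ _ _.
have sym_e : connect_sym e by apply/sym_connect_sym/generated_graph_sym.
have to_one u : connect e u one.
  apply: (@connect_to_one t s).
  by have := finField_expr_eq1 (vertex_neq0 u); rewrite cardF addn1.
split=> [|u v]; first by apply/card_gt0P; exists one.
by apply: connect_trans (to_one u) _; rewrite sym_e.
Qed.

End FiniteField.

(** The smallest prime factor of a composite n is a nonzero non-unit. *)
Lemma Zp_nonzero_unit_prime (n : nat) : (1 < n)%N ->
  (forall x : 'Z_n, x != 0 -> x \is a GRing.unit) -> prime n.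
Proof.
move=> n_gt1 unitP; have n_gt0 := ltnW n_gt1.
have pr_p := pdiv_prime n_gt1.
have := pdiv_leq n_gt0; rewrite leq_eqVlt => /predU1P[<- // | p_lt_n].
have /unitP : (pdiv n)%:R != 0 :> 'Z_n.
  by rewrite -val_eqE /= val_Zp_nat // modn_small // -lt0n prime_gt0.
rewrite unitZpE // coprime_sym prime_coprime // => /negP[]; exact: pdiv_dvd.
Qed.

Theorem proposition6 (n : nat) (hn : (2 <= n)%N) :
  connected_graph
    (generated_graph (V := [set~ (0%R : 'Z_n)])
       (fun x : 'Z_n => (x ^+ 2)%R) (fun x : 'Z_n => (x ^+ 3)%R))
  <-> pierpont_prime n.
Proof.
have prime_case : prime n ->
  connected_graph
    (generated_graph (V := [set~ (0%R : 'Z_n)])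
       (fun x : 'Z_n => (x ^+ 2)%R) (fun x : 'Z_n => (x ^+ 3)%R))
  <-> exists s t : nat, n = (2 ^ t * 3 ^ s + 1)%N.
  move=> pr_n.
  (* The field 'F_n is by definition the ring 'Z_(pdiv n). *)
  have : connected_graph
    (generated_graph (V := [set~ (0%R : 'Z_(pdiv n))])
       (fun x : 'Z_(pdiv n) => (x ^+ 2)%R) (fun x : 'Z_(pdiv n) => (x ^+ 3)%R))
    <-> exists s t : nat, #|'F_n| = (2 ^ t * 3 ^ s + 1)%N
    := finField_connectedP 'F_n.
  by rewrite card_Fp // pdiv_id.
split=> [conn | [pr_n pierpont_n]]; last exact/prime_case.
suff pr_n : prime n by split=> //; apply/prime_case.
apply: Zp_nonzero_unit_prime => // x x_neq0; case: conn => _ conn.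
have x_in : x \in [set~ 0] by rewrite !inE.
have one_in : 1 \in [set~ (0 : 'Z_n)] by rewrite !inE oner_neq0.
have /(connect_invariant (P := fun y => y \is a GRing.unit)) :=
  conn (Sub x x_in) (Sub 1 one_in).
by rewrite /= unitr1; apply=> y; rewrite unitrX_pos.
Qed.
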